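(* If $p,q,m$ are odd integers and $r$ is an even integer such that $pq+pr+qr=-m^2$, then $p+q\equiv 0 \pmod 8$. *)

(* Defs.v *)
From Stdlib Require Export ZArith.

(* Main.v *)
(** Write [s = p + q] and [u = p + r].  The hypothesis reads [s * u = p^2 - m^2],
    and odd squares are 1 modulo 8, so 8 divides [s * u]; as [u] is odd, 8
    divides [s]. *)
Require Import Defs.
From Stdlib Require Import ZArith Lia.
Local Open Scope Z_scope.

(** Adding [p^2] to both sides of the hypothesis factors its left side as [(p + q) * (p + r)].
    Oddness of [p] and [m] makes this product divisible by 8; oddness of [p + r] lets that factor be
    cancelled. *)

(** For [n = 2 * k + 1], [n^2 - 1 = 4 * k * (k + 1)], and one of [k], [k + 1] is even. *)
Lemma odd_square_mod8 (n : Z) : Z.Odd n -> (8 | n ^ 2 - 1).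
Proof.
  intros [k ->].
  destruct (Z.Even_or_Odd k) as [[j ->] | [j ->]].
  - exists (j * (2 * j + 1)); ring.
  - exists ((2 * j + 1) * (j + 1)); ring.
Qed.

Theorem proposition1p10 (p q m r : Z)
  (hp : Z.Odd p) (hq : Z.Odd q) (hm : Z.Odd m) (hr : Z.Even r)
  (h : p * q + p * r + q * r = - m ^ 2) :
  (p + q) mod 8 = 0.
Proof.
  assert (hu : Z.Odd (p + r)).
  { destruct hp as [a ->], hr as [b ->]; exists (a + b); ring. }
  assert (hs : (p + q) * (p + r) = (p ^ 2 - 1) - (m ^ 2 - 1)) by lia.
  apply Z.mod_divide; [lia |].
  (* [u] is its own inverse modulo 8. *)
  replace (p + q) with
    ((p + r) * ((p + q) * (p + r)) - (p + q) * ((p + r) ^ 2 - 1)) by ring.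
  rewrite hs.
  (* What remains concerns the squares of [p], [m] and [p + r], all odd. *)
  apply Z.divide_sub_r; apply Z.divide_mul_r; [apply Z.divide_sub_r |];
    now apply odd_square_mod8.
Qed.
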